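(* There is a sequence of inputs $(\Theta_i,n_i,G_i)_{i\in\mathbb{N}}$, where $G_i\subset\mathbb{R}^2$ is a set of $n_i$ points (guards), $\Theta_i>0$, $\lim_{i\to\infty}\Theta_i=0$ and $\lim_{i\to\infty}n_i=\infty$, such that the complexity of the $\Theta_i$-region of $G_i$ is $\Omega(n_i^2)$; that is, there is a constant $c>0$ such that for all sufficiently large $i$ the complexity of the $\Theta_i$-region of $G_i$ is at least $c\,n_i^2$.
   Context: A $\Theta$-cone is a planar cone (region between two rays from a common apex) with apex angle $\Theta$; cones are considered as open sets. A $\Theta$-cone is empty (with respect to $G$) if it contains no point of $G$. A point $p\in\mathbb{R}^2$ is $\Theta$-guarded (with respect to $G$) if every $\Theta$-cone with apex $p$ is non-empty. The $\Theta$-region of $G$ is the set of all $\Theta$-guarded points. For $0<\Theta<\pi$ its boundary is composed of finitely many circular arcs. The complexity of the $\Theta$-region is its combinatorial complexity, i.e. the total number of vertices and circular arcs (edges) forming its boundary. *)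

(* Defs.v *)
(* The plane is [R * R] with its product topology. *)
From mathcomp Require Import all_boot all_order all_algebra.
From mathcomp Require Import all_classical all_reals all_analysis.
Set Implicit Arguments.
Unset Strict Implicit.
Unset Printing Implicit Defensive.
Import Order.TTheory GRing.Theory Num.Theory.
Import numFieldNormedType.Exports.
Local Open Scope classical_set_scope.
Local Open Scope card_scope.
Local Open Scope ring_scope.

Definition polar (R : realType) (p : R * R) (r t : R) : R * R :=
  (p.1 + r * cos t, p.2 + r * sin t).

(* The bounding rays have directions [phi] and [phi + Theta]; both rays, and
   the apex [p], are excluded. *)
Definition cone (R : realType) (Theta : R) (p : R * R) (phi : R) :
    set (R * R) :=
  [set q | exists r t, [/\ 0 < r, phi < t < phi + Theta & q = polar p r t]].

Definition empty_cone (R : realType) (G C : set (R * R)) : Prop :=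
  C `&` G = set0.

Definition guarded (R : realType) (Theta : R) (G : set (R * R)) (p : R * R) :
    Prop :=
  forall phi : R, ~ empty_cone G (cone Theta p phi).

Definition region (R : realType) (Theta : R) (G : set (R * R)) :
    set (R * R) :=
  [set p | guarded Theta G p].

Definition boundary (R : realType) (A : set (R * R)) : set (R * R) :=
  closure A `\` interior A.

Definition open_arc (R : realType) (a : R * R) (r s w : R) : set (R * R) :=
  [set q | exists2 t, s < t < s + w & q = polar a r t].

(* Both endpoints of an edge are vertices. They coincide when [w = 2 * pi], so
   a full circle consists of one vertex and one edge. *)
Definition is_edge (R : realType) (V A : set (R * R)) : Prop :=
  exists a r s w, [/\ 0 < r, 0 < w <= 2 * pi, A = open_arc a r s w,
    V (polar a r s) & V (polar a r (s + w))].

Definition arc_decomposition (R : realType) (B V : set (R * R))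
    (E : set (set (R * R))) : Prop :=
  [/\ forall A, E A -> is_edge V A,
      forall A, E A -> A `&` V = set0,
      trivIset E id &
      B = V `|` \bigcup_(A in E) A].

(* Circular arcs may be subdivided by spurious vertices, hence the least total
   number of vertices and edges over all finite decompositions of the boundary
   of [A]. The value is [+oo] when the boundary of [A] is not a finite union of
   vertices and circular arcs, which does not happen for the region of a finite
   set of guards when [0 < Theta < pi]. *)
Definition complexity (R : realType) (A : set (R * R)) : \bar R :=
  ereal_inf [set x | exists V E (v e : nat),
    [/\ arc_decomposition (boundary A) V E, V #= `I_v, E #= `I_e
      & x = ((v + e)%:R)%:E]].

(* Main.v *)
(* Write w = pi / (40 k). Take 80 k very distant guards in the directions l w
   and delete those in the directions 0 and pi / 2; with an aperture slightly
   larger than w, a point near the origin is then unguarded only because of the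
   two gaps, of width 2 w, around 0 and pi / 2. Close the upper gap with the
   guards (5 w m, 1) and the right gap with (1, 5 w m), m < k. The gap is so
   wide that a close guard fills it only when seen almost exactly in its middle,
   so the upper gap is filled along k thin vertical strips and the right one
   along k thin horizontal strips. The region thus has k^2 separate pieces near
   the origin, each forcing its own vertex or edge of the boundary, whereas
   there are at most 82 k guards. *)
Require Import Defs.
From mathcomp Require Import all_boot all_order all_algebra.
From mathcomp Require Import all_classical all_reals all_analysis.
From mathcomp Require Import ring lra zify.
Import Order.TTheory GRing.Theory Num.Theory.
Import numFieldNormedType.Exports.
Local Open Scope classical_set_scope.
Local Open Scope card_scope.
Local Open Scope ring_scope.

(** * Cones as intersections of two half-planes *)

(* The cross product of the unit vector of direction [phi] with [q - p]:
   positive when [q] lies to the left of the ray from [p] in direction [phi]. *)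
Definition side {R : realType} (phi : R) (p q : R * R) : R :=
  cos phi * (q.2 - p.2) - sin phi * (q.1 - p.1).

Lemma side_polar {R : realType} (phi : R) (p : R * R) (r t : R) :
  side phi p (polar p r t) = r * sin (t - phi).
Proof. by rewrite /side /polar /= sinB; ring. Qed.

(** Below a straight angle a cone is the intersection of two open half-planes, so membership becomes
    two sign conditions. For the converse, [X] and [Y] are the coordinates of [q - p] in the frame
    rotated by [phi]. *)
Lemma coneP {R : realType} (Theta : R) (p : R * R) (phi : R) (q : R * R) :
  0 < Theta < pi ->
  cone Theta p phi q <-> 0 < side phi p q /\ side (phi + Theta) p q < 0.
Proof.
move=> /andP[T0 Tpi]; split.
  move=> [r [t [r0 /andP[lt1 lt2] ->]]]; rewrite !side_polar; split.
    by rewrite mulr_gt0// sin_gt0_pi//; lra.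
  rewrite pmulr_rlt0// -oppr_gt0 -sinN sin_gt0_pi//; lra.
set Y := side phi p q => -[Y0 side2].
pose X := cos phi * (q.1 - p.1) + sin phi * (q.2 - p.2).
pose r := Num.sqrt (X ^+ 2 + Y ^+ 2).
have s0 : 0 < X ^+ 2 + Y ^+ 2 by nra.
have r0 : 0 < r by rewrite sqrtr_gt0.
have rE : r ^+ 2 = X ^+ 2 + Y ^+ 2 by rewrite sqr_sqrtr// ltW.
have Xr : -1 <= X / r <= 1.
  by rewrite ler_pdivlMr// ler_pdivrMr//; apply/andP; split; nra.
(* [acos] takes values in [[0, pi]], which is the correct branch because [Y] is positive. *)
pose a := acos (X / r).
have ca : r * cos a = X.
  by rewrite /a acosK ?in_itv//= mulrC divfK// gt_eqF.
have sa0 : 0 <= sin a.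
  by rewrite sin_ge0_pi// acos_ge0//= acos_lepi.
have sa : r * sin a = Y.
  have rs0 : 0 <= r * sin a by apply: mulr_ge0 => //; exact: ltW.
  apply/eqP; rewrite -(@eqrXn2 _ 2)// ?ltW//; apply/eqP.
  by rewrite exprMn sin2cos2 mulrBr mulr1 -exprMn ca rE addrAC subrr add0r.
have qE : q = polar p r (phi + a).
  have cs := cos2Dsin2 phi.
  rewrite [q]surjective_pairing /polar cosD sinD; congr pair.
    have -> : r * (cos phi * cos a - sin phi * sin a) =
      cos phi * (r * cos a) - sin phi * (r * sin a) by ring.
    by transitivity (p.1 + (cos phi ^+ 2 + sin phi ^+ 2) * (q.1 - p.1));
      [rewrite cs; ring | rewrite ca sa /X /Y /side; ring].
  have -> : r * (sin phi * cos a + cos phi * sin a) =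
      sin phi * (r * cos a) + cos phi * (r * sin a) by ring.
  by transitivity (p.2 + (cos phi ^+ 2 + sin phi ^+ 2) * (q.2 - p.2));
    [rewrite cs; ring | rewrite ca sa /X /Y /side; ring].
have a0 : 0 < a.
  rewrite lt_neqAle acos_ge0// andbT; apply/eqP => a0.
  by move: sa; rewrite -a0 sin0; lra.
exists r, (phi + a); split=> //.
(* If [Theta <= a <= pi], then [sin (a - Theta)] is nonnegative, against [side2]. *)
rewrite ltrDl a0 ltrD2l ltNge; apply/negP => aT.
move: side2; rewrite qE side_polar pmulr_rlt0// ltNge.
rewrite sin_ge0_pi//.
have := acos_lepi Xr; rewrite -/a; lra.
Qed.

(** * Elementary trigonometric inequalities *)

Lemma sin_le_id {R : realType} (x : R) : 0 <= x -> sin x <= x.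
Proof.
rewrite le_eqVlt => /predU1P[<-|x0]; first by rewrite sin0.
have [|c _] := MVT x0 (fun y _ => is_derive_sin y).
  by apply: continuous_subspaceT => y; exact: continuous_sin.
by rewrite sin0 !subr0 => ->; rewrite ler_piMl ?cos_le1// ltW.
Qed.

Lemma cos_ge_half {R : realType} (x : R) : 0 <= x <= 1 / 2 -> 1 / 2 <= cos x.
Proof.
move=> /andP[x0 x2]; have pi2 := pihalf_ge1 R.
have s0 : 0 <= sin x by rewrite sin_ge0_pi//; lra.
have c0 : 0 <= cos x by rewrite cos_ge0_pihalf//; lra.
have sx := sin_le_id x x0; have := cos2Dsin2 x; nra.
Qed.

Lemma sin_ge_sin {R : realType} (e t : R) :
  0 <= e <= pi / 2 -> e <= t <= pi - e -> sin e <= sin t.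
Proof.
move=> /andP[e0 e2] /andP[et te].
have mono (a b : R) : 0 <= a <= pi / 2 -> 0 <= b <= pi / 2 -> a <= b ->
    sin a <= sin b.
  move=> ? ?; rewrite le_eqVlt => /predU1P[->//|ab].
  by rewrite ltW// ltr_sin// in_itv/=; lra.
have [t2|t2] := lerP t (pi / 2); first by apply: mono => //; lra.
have -> : sin t = sin (pi - t) by rewrite sinB sinpi cospi; ring.
by apply: mono; lra.
Qed.

(** * Connectedness and lower bounds on the complexity *)

(** Without a boundary point in [K], the interior and the closure of [A] have the same trace on [K];
    this trace is clopen and nonempty, hence all of [K]. *)
Lemma connected_meets_boundary {R : realType} (K A : set (R * R)) :
  connected K -> K `&` A !=set0 -> K `&` ~` A !=set0 ->
  K `&` boundary A !=set0.
Proof.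
move=> cK [x [Kx Ax]] [y [Ky nAy]]; apply: contrapT => noB.
have BE : K `&` A° = K `&` closure A.
  apply/seteqP; split=> z [Kz Az]; split=> //.
    by apply: subset_closure; exact: interior_subset.
  by apply: contrapT => nAz; apply: noB; exists z.
have KB : K `&` A° = K.
  apply: cK.
  - by rewrite BE; exists x; split=> //; exact: subset_closure.
  - by exists A°; first exact: open_interior.
  - by exists (closure A) => //; exact: closed_closure.
by apply: nAy; apply: interior_subset; have [] : (K `&` A°) y by rewrite KB.
Qed.

Lemma connected_open_arc {R : realType} (a : R * R) (r s w : R) :
  connected (open_arc a r s w).
Proof.
have -> : open_arc a r s w = polar a r @` `]s, s + w[%classic.
  apply/seteqP; split=> q [t st tq]; exists t => //.
apply: connected_continuous_connected.
  exact/connected_intervalP/interval_is_interval.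
apply: continuous_subspaceT => t.
have cx : a.1 + r * cos x @[x --> t] --> a.1 + r * cos t.
  apply: cvgD; first exact: cvg_cst.
  by apply: cvgM; [exact: cvg_cst|exact: continuous_cos].
have cy : a.2 + r * sin x @[x --> t] --> a.2 + r * sin t.
  apply: cvgD; first exact: cvg_cst.
  by apply: cvgM; [exact: cvg_cst|exact: continuous_sin].
exact: cvg_pair cx cy.
Qed.

Lemma connected_sub_open {T : topologicalType} (U K : set T) :
  connected K -> open U -> closure U `&` K `<=` U -> K `&` U !=set0 ->
  K `<=` U.
Proof.
move=> cK oU clU KU; suff <- : K `&` U = K by exact: subIsetr.
apply: cK => //; first by exists U.
exists (closure U); first exact: closed_closure.
apply/seteqP; split=> z [Kz Uz]; split=> //; first exact: subset_closure.
exact: clU.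
Qed.

(* A vertex or an edge meeting [U i] is contained in [U i], because edges are
   connected. *)
Lemma complexity_ge_card {R : realType} (I : finType) (A : set (R * R))
    (U : I -> set (R * R)) :
  (forall i, open (U i)) ->
  (forall i, closure (U i) `&` boundary A `<=` U i) ->
  (forall i j, U i `&` U j !=set0 -> i = j) ->
  (forall i, U i `&` boundary A !=set0) ->
  ((#|I|%:R)%:E <= complexity A)%E.
Proof.
move=> oU clU dU mU; apply: le_ereal_inf_tmp => _ [V [E [v [e [dec Vv Ee ->]]]]].
rewrite lee_fin ler_nat; case: dec => edgeE _ _ bE.
have /pcard_leP[f] : V #<= `I_v by have := Vv; rewrite card_eq_le => /andP[].
have /pcard_leP[g] : E #<= `I_e by have := Ee; rewrite card_eq_le => /andP[].
(* [P i s] says that the vertex or edge numbered [s] lies in [U i]. Since the [U i] are disjoint and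
   edges are required nonempty, a choice of such pieces is injective in [i]. *)
pose P i (s : 'I_v + 'I_e) := match s with
  | inl a => exists y, [/\ V y, U i y & f y = a :> nat]
  | inr b => exists B, [/\ E B, B `<=` U i, B !=set0 & g B = b :> nat]
  end.
have /choice[h hP] : forall i, exists s, P i s.
  move=> i; have [x [Ux]] := mU i; rewrite bE => -[Vx|[B EB Bx]].
    have lt : (f x < v)%N by have := @funS _ _ _ _ f x Vx.
    by exists (inl (Ordinal lt)); exists x.
  have lt : (g B < e)%N by have := @funS _ _ _ _ g B EB.
  exists (inr (Ordinal lt)); exists B; split=> //; last by exists x.
  apply: connected_sub_open => //; last by exists x.
    by have [a [r [s [w [_ _ -> _ _]]]]] := edgeE _ EB; exact: connected_open_arc.
  move=> z [clz Bz]; apply: clU; split=> //.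
  by rewrite bE; right; exists B.
rewrite -[v]card_ord -[e]card_ord -card_sum; apply: (leq_card h) => i j hij.
have := hP i; have := hP j; rewrite -hij; case: (h i) => [a|b] /=.
  move=> [y [Vy Uy fy]] [z [Vz Uz fz]].
  have yz : z = y.
    apply: (@inj _ _ _ f); rewrite ?inE//.
    by rewrite [LHS]fz [RHS]fy.
  by apply: dU; exists z; split=> //; rewrite yz.
move=> [y [Vy Uy [x yx] fy]] [z [Vz Uz _ fz]].
have yz : z = y.
  apply: (@inj _ _ _ g); rewrite ?inE//.
  by rewrite [LHS]fz [RHS]fy.
by apply: dU; exists x; split; [apply: Uz; rewrite yz|exact: Uy].
Qed.

(** The norm is the maximum norm, so around each [c i] there is an open square frame free of [A],
    hence free of its boundary. The open balls of radius [d], whose rims lie in these frames, are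
    disjoint and each isolates some boundary points. *)
Lemma complexity_ge_isolated {R : realType} (I : finType) (A : set (R * R))
    (c : I -> R * R) (d : R) :
  0 < d -> (forall i, A (c i)) ->
  (forall i p, d / 2 < `|p - c i| < 2 * d -> ~ A p) ->
  (forall i j, i != j -> 2 * d <= `|c i - c j|) ->
  ((#|I|%:R)%:E <= complexity A)%E.
Proof.
move=> d0 Ac nA sep.
have dist_cont i : continuous (fun p : R * R => `|p - c i|).
  move=> p; apply: cvg_norm; apply: cvgB; [exact: cvg_id|exact: cvg_cst].
pose U i := [set p | `|p - c i| < d].
have nB i p : d / 2 < `|p - c i| < 2 * d -> ~ boundary A p.
  move=> pi [clp _].
  have : nbhs p [set q | d / 2 < `|q - c i| < 2 * d].
    apply: (@open_nbhs_nbhs _ p); split=> //.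
    have -> : [set q | d / 2 < `|q - c i| < 2 * d] =
      (fun q => `|q - c i|) @^-1` `]d / 2, 2 * d[%classic.
      by apply/seteqP; split=> q /=; rewrite in_itv.
    by apply: open_comp => // q _; exact: dist_cont.
  by move=> /clp [q [Aq]] /nA.
apply: (@complexity_ge_card _ _ _ U).
- move=> i.
  have -> : U i = (fun q => `|q - c i|) @^-1` `]-oo, d[%classic.
    by apply/seteqP; split=> q /=; rewrite in_itv.
  by apply: open_comp => // q _; exact: dist_cont.
- move=> i p [clp bp]; rewrite /U /= ltNge; apply/negP => dp.
  apply: (nB i p) => //; apply/andP; split; first lra.
  have : `|p - c i| <= d; last lra.
  have cl : closed [set q : R * R | `|q - c i| <= d].
    have -> : [set q : R * R | `|q - c i| <= d] =
        (fun q => `|q - c i|) @^-1` `]-oo, d]%classic.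
      by apply/seteqP; split=> q /=; rewrite in_itv.
    by apply: closed_comp => // q _; exact: dist_cont.
  apply: (cl p); apply: closureS clp => q; exact: ltW.
- move=> i j [p [pi pj]]; apply: contrapT => /eqP /sep.
  apply/negP; rewrite -ltNge -(subrKA p) mulr2n mulrDl !mul1r.
  rewrite (le_lt_trans (ler_normD _ _))// ltrD//.
  by rewrite distrC.
- move=> i.
  (* A horizontal segment of length [3 * d / 4] starts in [A], ends in the frame and stays in [U i],
     so it crosses the boundary there. *)
  pose s (t : R) : R * R := c i + (t, 0).
  have sE t : 0 <= t -> `|s t - c i| = t.
    move=> t0; rewrite /s addrAC subrr add0r prod_normE /= normr0 ger0_norm//.
    exact/max_idPl.
  have [|||z [[t]]] := @connected_meets_boundary R (s @` `[0, 3 * d / 4]%classic) A.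
  + apply: connected_continuous_connected; first exact: segment_connected.
    apply: continuous_subspaceT => t.
    apply: cvgD; first exact: cvg_cst.
    exact: cvg_pair cvg_id (cvg_cst _).
  + exists (c i); split=> //; exists 0; last by rewrite /s addr0.
    by rewrite /= in_itv/= lexx/=; lra.
  + exists (s (3 * d / 4)); split.
      by exists (3 * d / 4) => //=; rewrite in_itv/= lexx andbT; lra.
    by apply: (nA i); rewrite sE; lra.
  rewrite /= in_itv /= => /andP[t0 t1] <- bz; exists (s t); split=> //.
  by rewrite /U /= sE//; lra.
Qed.

(** * Full turns and the configuration of guards *)

Lemma polar_period {R : realType} (p : R * R) (r t : R) (z : int) :
  polar p r (t + z%:~R * (2 * pi)) = polar p r t.
Proof.
have posE (n : nat) u : polar p r (u + n%:R * (2 * pi)) = polar p r u.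
  have -> : n%:R * (2 * pi) = pi *+ 2 *+ n :> R by rewrite mulr_natl [2 * pi]mulr_natl.
  by rewrite /polar (periodicn (@sinD2pi R)) (periodicn (@cosD2pi R)).
case: z => n; first exact: posE.
by rewrite NegzE mulrNz mulNr -(posE n.+1 (t - _)) subrK.
Qed.

(** A full turn is [80 * k] pitches, a right angle [20 * k]. *)
Definition pitch {R : realType} (k : nat) : R := pi / (40 * k%:R).

Definition slack {R : realType} (k : nat) : R := pitch k / 64.

(* Chosen so that seeing a far guard from near the origin rather than from the
   origin itself cannot affect comparisons of angles with margin [slack k]. *)
Definition far_radius {R : realType} (k : nat) : R := 4 / sin (slack k).

Definition near_guards {R : realType} (k : nat) : set (R * R) :=
  [set q | exists2 m, (m < k)%N & q = (5 * pitch k * m%:R, 1)].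

(** The index ranges over all integers, so every multiple of the pitch can be tested directly; each
    guard recurs modulo [80 * k]. The two conditions delete the directions 0 and [pi / 2]. *)
Definition far_guards {R : realType} (k : nat) : set (R * R) :=
  [set q | exists2 l : int, ~~ ((80 * k)%N%:Z %| l)%Z && ~~ ((80 * k)%N%:Z %| l - (20 * k)%N%:Z)%Z
    & q = polar (0, 0) (far_radius k) (l%:~R * pitch k)].

Definition guards {R : realType} (k : nat) : set (R * R) :=
  near_guards k `|` [set (q.2, q.1) | q in near_guards k] `|` far_guards k.

(** Every cone then contains a multiple of the pitch at least [slack k] away from both rays, yet is
    narrower than a gap of two pitches. *)
Definition aperture {R : realType} (k : nat) : R := pitch k + 2 * slack k.

Lemma pitch_gt0 {R : realType} {k : nat} : (0 < k)%N -> 0 < pitch k :> R.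
Proof. by move=> k0; rewrite divr_gt0 ?pi_gt0// mulr_gt0 ?ltr0n. Qed.

Lemma pitch_pi {R : realType} {k : nat} :
  (0 < k)%N -> k%:R * pitch k = pi / 40 :> R.
Proof. by move=> k0; rewrite /pitch; field; rewrite pnatr_eq0 -lt0n. Qed.

Lemma pitch_le {R : realType} {k : nat} : (0 < k)%N -> pitch k <= 1 / 10 :> R.
Proof.
move=> k0; have := pitch_pi (R := R) k0; have := pihalf_lt2 R.
have := pitch_gt0 (R := R) k0.
have : 1 <= k%:R :> R by rewrite ler1n.
nra.
Qed.

Lemma near_coord {R : realType} {k m : nat} :
  (m < k)%N -> 0 <= (5 * pitch k * m%:R : R) <= 1 / 2 - 5 * pitch k.
Proof.
move=> mk; have k0 : (0 < k)%N by lia.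
have w0 := pitch_gt0 (R := R) k0; have := pitch_pi (R := R) k0.
have := pihalf_lt2 R; have m0 : 0 <= m%:R :> R by [].
have : m%:R + 1 <= k%:R :> R by rewrite natr1 ler_nat.
nra.
Qed.

(** The bound 4 exceeds the shift of at most 2 in [offset_le], so the side on which a far guard is
    seen is the same from [p] as from the origin. *)
Lemma far_radius_sin {R : realType} {k : nat} {t : R} : (0 < k)%N ->
  slack k <= t <= pi - slack k -> 4 <= far_radius k * sin t.
Proof.
move=> k0 te; have w0 := pitch_gt0 (R := R) k0; have wl := pitch_le (R := R) k0.
have pi2 := pi_ge2 R.
have se : 0 < sin (slack k) :> R.
  by rewrite sin_gt0_pi// /slack; lra.
rewrite /far_radius mulrAC ler_pdivlMr// ler_pM2l// sin_ge_sin//.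
by rewrite /slack; lra.
Qed.

Lemma side_origin {R : realType} (phi : R) (p : R * R) (r t : R) :
  side phi p (polar (0, 0) r t) =
    r * sin (t - phi) - (cos phi * p.2 - sin phi * p.1).
Proof. by rewrite /side /polar /= sinB; ring. Qed.

Lemma offset_le {R : realType} (phi : R) (p : R * R) :
  -1 <= p.1 <= 1 -> -1 <= p.2 <= 1 ->
  -2 <= cos phi * p.2 - sin phi * p.1 <= 2.
Proof.
move=> p1 p2; have := cos_le1 phi; have := cos_geN1 phi.
have := sin_le1 phi; have := sin_geN1 phi; nra.
Qed.

Lemma aperture_bounds {R : realType} {k : nat} : (0 < k)%N ->
  0 < (aperture k : R) < pi.
Proof.
move=> k0; have w0 := pitch_gt0 (R := R) k0; have wl := pitch_le (R := R) k0.
have pi2 := pi_ge2 R; rewrite /aperture /slack; lra.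
Qed.

(** * The guarded cell centres *)

(** Every cone contains a direction [t] that is a multiple of the pitch. Either a far guard stands
    in that direction, or [t] is 0 or [pi / 2] up to full turns and a near guard lies exactly to the
    right of [p] or exactly above it. *)
Lemma cell_guarded {R : realType} {k i j : nat} : (i < k)%N -> (j < k)%N ->
  region (aperture k) (guards k) (5 * pitch k * i%:R, 5 * pitch k * j%:R : R).
Proof.
move=> ik jk phi; set p := (_, _).
have k0 : (0 < k)%N by lia.
have w0 := pitch_gt0 (R := R) k0; have wl := pitch_le (R := R) k0.
have pi2 := pi_ge2 R.
have ci := near_coord (R := R) ik; have cj := near_coord (R := R) jk.
pose x := (phi + slack k) / pitch k.
have xE : x * pitch k = phi + slack k by rewrite divfK// gt_eqF.
(* The first multiple of the pitch beyond [phi + slack k] is still at least [slack k] before the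
   second ray. *)
pose l : int := Num.floor x + 1.
have lx : x < l%:~R <= x + 1.
  have := floor_itv x; rewrite -/l => /andP[xl ->].
  by rewrite /l intrD lerD2r.
pose t : R := l%:~R * pitch k.
have lt : phi + slack k < t <= phi + slack k + pitch k.
  by rewrite -xE /t; nra.
have tcone : phi < t < phi + aperture k by rewrite /aperture /slack in lt *; lra.
have kk : k%:R * pitch k * 80 = 2 * pi :> R by rewrite pitch_pi//; lra.
suff [q Gq Cq] : exists2 q, guards k q & cone (aperture k) p phi q.
  by rewrite /empty_cone => e0; have : set0 q by rewrite -e0.
have [/dvdzP[z lE]|n1] := boolP ((80 * k)%N%:Z %| l)%Z.
  exists (polar p (1 - p.1) t); last by exists (1 - p.1), t; split=> //=; lra.
  have -> : t = 0 + z%:~R * (2 * pi) by rewrite /t lE !intrM -kk; ring.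
  rewrite polar_period; left; right; exists (p.2, 1); first by exists j.
  by rewrite /polar cos0 sin0 /=; congr pair; ring.
have [/dvdzP[z lE]|n2] := boolP ((80 * k)%N%:Z %| l - (20 * k)%N%:Z)%Z.
  exists (polar p (1 - p.2) t); last by exists (1 - p.2), t; split=> //=; lra.
  have -> : t = pi / 2 + z%:~R * (2 * pi).
    have -> : pi / 2 = (20 * k)%:R * pitch k :> R.
      by rewrite natrM -mulrA pitch_pi//; field.
    have -> : t = ((l - (20 * k)%N%:Z)%:~R + (20 * k)%:R) * pitch k.
      by rewrite /t intrB subrK.
    by rewrite lE !intrM -kk; ring.
  rewrite polar_period; left; left; exists i => //.
  by rewrite /polar cos_pihalf sin_pihalf /=; congr pair; ring.
exists (polar (0, 0) (far_radius k) t); first by right; exists l; rewrite ?n1 ?n2.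
apply/coneP; first exact: aperture_bounds.
rewrite !side_origin.
have p1 : -1 <= p.1 <= 1 by rewrite /=; lra.
have p2 : -1 <= p.2 <= 1 by rewrite /=; lra.
have b1 := offset_le phi p p1 p2.
have b2 := offset_le (phi + aperture k) p p1 p2.
have s1 : 4 <= far_radius k * sin (t - phi).
  by apply: far_radius_sin => //; rewrite /slack in lt *; lra.
have s2 : 4 <= far_radius k * sin (phi + aperture k - t).
  by apply: far_radius_sin => //; rewrite /aperture /slack in lt *; lra.
rewrite -opprB sinN mulrN in s2.
by split; lra.
Qed.

(** * Unguarded points: cones inside the upper gap *)

Lemma int_residue (a n l : int) : 0 < n ->
  exists z, - a <= l - z * n < n - a.
Proof.
move=> n0; exists ((l + a) %/ n)%Z.
have := divz_eq (l + a) n; have := modz_ge0 (l + a) (lt0r_neq0 n0).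
have := ltz_pmod (l + a) n0; lia.
Qed.

(** The far directions next to the gap are [pi / 2] plus or minus one pitch, and both rays stay
    [slack k] inside them. *)
Lemma far_guards_outside {R : realType} {k : nat} (p : R * R) (psi1 psi2 : R)
    (q : R * R) : (0 < k)%N ->
  -1 <= p.1 <= 1 -> -1 <= p.2 <= 1 ->
  slack k <= psi1 <= pitch k - slack k ->
  slack k <= psi2 <= pitch k - slack k ->
  far_guards k q ->
  side (pi / 2 - psi1) p q <= 0 \/ 0 <= side (pi / 2 + psi2) p q.
Proof.
move=> k0 p1 p2 b1 b2 [l /andP[_ nl] ->]; rewrite !side_origin.
have w0 := pitch_gt0 (R := R) k0.
(* This window of directions runs from [- pi / 2] to [3 * pi / 2], half a turn on each side of the
   gap; guards in the first half fail at the first ray, the others at the second. *)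
have [|z] := int_residue (20 * k)%N%:Z (80 * k)%N%:Z l; first by rewrite ltz_nat muln_gt0.
set l' : int := l - z * (80 * k)%N%:Z => /andP[l'_ge l'_lt].
have {}l'_lt : l' < (60 * k)%N%:Z by move: l'_lt; clearbody l'; clear; lia.
have l'_neq : l' != (20 * k)%N%:Z.
  apply/negP => /eqP l'E; move/negP: nl; apply; apply/dvdzP; exists z.
  by rewrite -l'E /l'; ring.
have sinE phi : sin (l%:~R * pitch k - phi) = sin (l'%:~R * pitch k - phi) :> R.
  have -> : l%:~R * pitch k - phi = l'%:~R * pitch k - phi + z%:~R * (2 * pi) :> R.
    have -> : 2 * pi = (80 * k)%N%:R * pitch k :> R.
      by rewrite natrM -mulrA pitch_pi//; field.
    by rewrite /l' intrB intrM; ring.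
  by have [_] := polar_period (0, 0) 1 (l'%:~R * pitch k - phi) z;
    rewrite !add0r !mul1r.
have o1 := offset_le (pi / 2 - psi1) p p1 p2.
have o2 := offset_le (pi / 2 + psi2) p p1 p2.
have pE : pi = (40 * k)%:R * pitch k :> R.
  by rewrite natrM -mulrA pitch_pi//; field.
have natE (n : nat) : n%:R = n%:~R :> R by [].
have oneE : 1 = 1%:~R :> R by [].
rewrite !sinE.
have [l'_small|l'_big] := ltP l' (20 * k)%N%:Z; [left|right].
  rewrite -[l'%:~R * _ - _]opprB sinN mulrN.
  have : 4 <= far_radius k * sin (pi / 2 - psi1 - l'%:~R * pitch k).
    apply: far_radius_sin => //.
    have : l'%:~R + 1 <= (20 * k)%:R :> R by rewrite oneE natE -intrD ler_int lezD1.
    have : - (20 * k)%:R <= l'%:~R :> R by rewrite natE -intrN ler_int.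
    rewrite pE !natrM => h1 h2; apply/andP; split; nra.
  by lra.
have : 4 <= far_radius k * sin (l'%:~R * pitch k - (pi / 2 + psi2)).
  apply: far_radius_sin => //.
  have : (20 * k)%:R + 1 <= l'%:~R :> R.
    by rewrite oneE natE -intrD ler_int lezD1 lt_neqAle eq_sym l'_neq.
  have : l'%:~R + 1 <= (60 * k)%:R :> R.
    by rewrite oneE natE -intrD ler_int lezD1.
  rewrite pE !natrM => h1 h2; apply/andP; split; nra.
by lra.
Qed.

(* The witness is the cone spanning the directions from [pi / 2 - psi1] to
   [pi / 2 + psi2]. *)
Lemma gap_unguarded {R : realType} {k : nat} (p : R * R) (psi1 psi2 : R) :
  (0 < k)%N -> -1 <= p.1 <= 1 / 2 -> -1 <= p.2 <= 1 ->
  slack k <= psi1 <= pitch k - slack k ->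
  slack k <= psi2 <= pitch k - slack k ->
  psi1 + psi2 = aperture k ->
  (forall m : nat, (m < k)%N ->
     sin psi1 * (1 - p.2) <= cos psi1 * (5 * pitch k * m%:R - p.1) \/
     sin psi2 * (1 - p.2) <= cos psi2 * (p.1 - 5 * pitch k * m%:R)) ->
  ~ region (aperture k) (guards k) p.
Proof.
move=> k0 p1 p2 b1 b2 psiE near /(_ (pi / 2 - psi1)); apply.
have w0 := pitch_gt0 (R := R) k0; have wl := pitch_le (R := R) k0.
rewrite /empty_cone -subset0 => q [/coneP -/(_ (aperture_bounds k0)) + Gq].
have -> : pi / 2 - psi1 + aperture k = pi / 2 + psi2 by lra.
move=> [side1 side2].
suff [] : side (pi / 2 - psi1) p q <= 0 \/ 0 <= side (pi / 2 + psi2) p q by lra.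
have sideE1 : side (pi / 2 - psi1) p q =
    sin psi1 * (q.2 - p.2) - cos psi1 * (q.1 - p.1).
  by rewrite /side cosB sinB cos_pihalf sin_pihalf; ring.
have sideE2 : side (pi / 2 + psi2) p q =
    - (sin psi2 * (q.2 - p.2) + cos psi2 * (q.1 - p.1)).
  by rewrite /side cosD sinD cos_pihalf sin_pihalf; ring.
case: Gq => [[[m mk qE]|[_ [m mk ->] qE]]|]; last first.
- by apply: far_guards_outside => //; lra.
(* A guard of the right column is at least 1/2 to the right of [p] and at most 3/2 above it, whereas
   the first ray is almost vertical. *)
- left; rewrite sideE1 -qE /=.
  have s0 : 0 <= sin psi1.
    by rewrite sin_ge0_pi//; have := pi_ge2 R; rewrite /slack in b1; lra.
  have s1 : sin psi1 <= psi1.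
    by apply: sin_le_id; rewrite /slack in b1; lra.
  have c1 : 1 / 2 <= cos psi1.
    by apply: cos_ge_half; rewrite /slack in b1; lra.
  have := near_coord (R := R) mk; rewrite /slack in b1; nra.
- rewrite sideE1 sideE2 qE /=.
  by have [h|h] := near m mk; [left|right]; lra.
Qed.

(** * Reflection in the diagonal and the unguarded strips *)

(** The reflection turns direction [t] into [pi / 2 - t], so it exchanges the first and second rays
    of a cone. *)
Lemma guarded_swap {R : realType} (Theta : R) (G : set (R * R)) (p : R * R) :
  (forall q, G q -> G (q.2, q.1)) ->
  region Theta G p -> region Theta G (p.2, p.1).
Proof.
move=> GS gp phi; have := gp (pi / 2 - phi - Theta).
apply: contra_not => e0; rewrite /empty_cone -subset0 => q [[r [t [r0 lt qE]]] Gq].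
suff : set0 (q.2, q.1) by [].
rewrite -e0; split; last exact: GS.
exists r, (pi / 2 - t); split => //; first lra.
by rewrite qE /polar /= cosB sinB cos_pihalf sin_pihalf; congr pair; ring.
Qed.

Lemma guards_swap {R : realType} (k : nat) (q : R * R) :
  (0 < k)%N -> guards k q -> guards k (q.2, q.1).
Proof.
move=> k0 [[nq|[q' nq' <-]]|[l /andP[n1 n2] ->]].
- by left; right; exists q.
- by left; left; rewrite /= -surjective_pairing.
right; exists ((20 * k)%N%:Z - l).
  by rewrite -[l - _]opprB rpredN in n2; rewrite n2 addrAC subrr add0r rpredN n1.
have -> : ((20 * k)%N%:Z - l)%:~R * pitch k = pi / 2 - l%:~R * pitch k :> R.
  have -> : pi / 2 = (20 * k)%:R * pitch k :> R.
    by rewrite natrM -mulrA pitch_pi//; field.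
  by rewrite intrB mulrBl.
by rewrite /polar /= cosB sinB cos_pihalf sin_pihalf; congr pair; ring.
Qed.

(** Guard [i] of the upper row is off the vertical through [p] by more than a quarter pitch, the
    guards beyond [p] on the other side by at least four pitches. A cone tilted away from guard [i]
    passes between them. *)
Lemma strip_unguarded {R : realType} {k i : nat} (p : R * R) : (i < k)%N ->
  -1 / 10 <= p.1 <= 1 / 2 -> -1 / 10 <= p.2 <= 1 / 2 ->
  pitch k / 4 < `|p.1 - 5 * pitch k * i%:R| < pitch k ->
  ~ region (aperture k) (guards k) p.
Proof.
move=> ik p1 p2 /andP[d1 d2].
have k0 : (0 < k)%N by lia.
have w0 := pitch_gt0 (R := R) k0; have wl := pitch_le (R := R) k0.
have pi2 := pi_ge2 R.
(* The tilts [a] and [b] add up to the aperture: [b], a sixteenth of a pitch, is used on the side of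
   guard [i], and [a] on the other. *)
pose a : R := pitch k - 2 * slack k; pose b : R := 4 * slack k.
have sa0 : 0 <= sin a by rewrite sin_ge0_pi// /a /slack; lra.
have sa1 : sin a <= pitch k.
  by have := sin_le_id a; rewrite /a /slack; lra.
have ca : 1 / 2 <= cos a by apply: cos_ge_half; rewrite /a /slack; lra.
have sb0 : 0 <= sin b by rewrite sin_ge0_pi// /b /slack; lra.
have sb1 : sin b <= pitch k / 16.
  by have := sin_le_id b; rewrite /b /slack; lra.
have cb : 1 / 2 <= cos b by apply: cos_ge_half; rewrite /b /slack; lra.
have far_a y : 4 * pitch k <= y -> sin a * (1 - p.2) <= cos a * y by nra.
have far_b y : pitch k / 4 <= y -> sin b * (1 - p.2) <= cos b * y by nra.
have mono m n : (m <= n)%N -> 5 * pitch k * m%:R <= 5 * pitch k * n%:R :> R.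
  by move=> mn; rewrite ler_pM2l ?ler_nat// mulr_gt0.
have stepS m : 5 * pitch k * m.+1%:R = 5 * pitch k * m%:R + 5 * pitch k :> R.
  by rewrite -[m.+1%:R]natr1 mulrDr mulr1.
have [pi_lt|pi_ge] := ltP p.1 (5 * pitch k * i%:R).
  rewrite ltr0_norm ?subr_lt0// in d1 d2.
  apply: (gap_unguarded p b a) => //; rewrite /a /b /aperture /slack; [lra..|].
  move=> m mk; have [im|mi] := leqP i m; [left|right].
    by apply: far_b; have := mono _ _ im; lra.
  by apply: far_a; have := mono _ _ mi; rewrite stepS; lra.
rewrite ger0_norm ?subr_ge0// in d1 d2.
apply: (gap_unguarded p a b) => //; rewrite /a /b /aperture /slack; [lra..|].
move=> m mk; have [mi|im] := leqP m i; [right|left].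
  by apply: far_b; have := mono _ _ mi; lra.
by apply: far_a; have := mono _ _ im; rewrite stepS; lra.
Qed.

(** * Quadratic complexity and the number of guards *)

Lemma complexity_guards {R : realType} {k : nat} : (0 < k)%N ->
  (((k * k)%N%:R)%:E <= complexity (region (aperture k) (guards k : set (R * R))))%E.
Proof.
move=> k0; have w0 := pitch_gt0 (R := R) k0; have wl := pitch_le (R := R) k0.
have -> : (k * k)%N = #|{: 'I_k * 'I_k}| by rewrite card_prod card_ord.
pose c (i : 'I_k * 'I_k) : R * R := (5 * pitch k * i.1%:R, 5 * pitch k * i.2%:R).
(* With this radius the frames reach from a quarter pitch to one pitch. In a frame some coordinate
   is off by more than a quarter pitch; the second coordinate reduces to the first by reflection. *)
apply: (@complexity_ge_isolated _ _ _ c (pitch k / 2)).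
- by rewrite divr_gt0.
- by move=> i; exact: cell_guarded.
- move=> i p.
  have -> : pitch k / 2 / 2 = pitch k / 4 :> R by field.
  have -> : 2 * (pitch k / 2) = pitch k :> R by field.
  rewrite prod_normE /= lt_max gt_max => /andP[d1 /andP[d2 d3]].
  have c1 := near_coord (R := R) (ltn_ord i.1).
  have c2 := near_coord (R := R) (ltn_ord i.2).
  have p1 : -1 / 10 <= p.1 <= 1 / 2 by move: d2; rewrite ltr_norml; lra.
  have p2 : -1 / 10 <= p.2 <= 1 / 2 by move: d3; rewrite ltr_norml; lra.
  case/orP: d1 => d1.
    by apply: (strip_unguarded p (ltn_ord i.1)) => //; rewrite d1 d2.
  move=> /(guarded_swap _ _ _ (fun q => guards_swap k q k0)).
  by apply: (strip_unguarded (p.2, p.1) (ltn_ord i.2)) => //=; rewrite d1 d3.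
- have sep (m n : nat) : m != n ->
      pitch k <= `|5 * pitch k * m%:R - 5 * pitch k * n%:R| :> R.
    wlog mn : m n / (m < n)%N => [hw|_].
      rewrite neq_ltn => /orP[mn|nm]; first by apply: hw; rewrite // ltn_eqF.
      by rewrite distrC; apply: hw; rewrite // ltn_eqF.
    rewrite distrC ger0_norm; last first.
      rewrite subr_ge0; apply: ler_wpM2l; last by rewrite ler_nat ltnW.
      by rewrite mulr_ge0// ltW.
    have : m%:R + 1 <= n%:R :> R by rewrite natr1 ler_nat.
    nra.
  move=> [i1 i2] [j1 j2]; rewrite xpair_eqE negb_and => ij.
  have -> : 2 * (pitch k / 2) = pitch k :> R by field.
  rewrite prod_normE /= le_max; apply/orP.
  by case/orP: ij => /sep; [left|right].
Qed.

(** [f] lists the upper row, the right column and all [80 * k] far directions, the deleted ones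
    included. *)
Lemma guards_card_le {R : realType} (k : nat) : (0 < k)%N ->
  (guards k : set (R * R)) #<= `I_(82 * k).
Proof.
move=> k0.
pose f (m : nat) : R * R :=
  if (m < k)%N then (5 * pitch k * m%:R, 1)
  else if (m < 2 * k)%N then (1, 5 * pitch k * (m - k)%N%:R)
  else polar (0, 0) (far_radius k) ((m - 2 * k)%N%:R * pitch k).
apply: (@card_le_trans _ _ _ (f @` `I_(82 * k))); last exact: card_image_le.
apply: subset_card_le => q [[[m mk ->]|[_ [m mk ->] <-]]|[l _ ->]].
- by exists m; rewrite /= ?/f ?mk//; lia.
- exists (m + k)%N; first by rewrite /=; lia.
  have -> : f (m + k)%N = (1, 5 * pitch k * (m + k - k)%N%:R).
    by rewrite /f ltnNge leq_addl /= ifT//; lia.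
  by rewrite addnK.
have [|z] := int_residue 0 (80 * k)%N%:Z l; first by rewrite ltz_nat muln_gt0.
rewrite oppr0 subr0; case lE : (l - _) => [r|//]; rewrite ltz_nat /= => rk.
exists (r + 2 * k)%N; first by rewrite /=; lia.
rewrite /f !ifF ?addnK; [|by lia|by lia].
rewrite -(polar_period _ _ _ z); congr polar.
have -> : 2 * pi = (80 * k)%N%:R * pitch k :> R.
  by rewrite natrM -mulrA pitch_pi//; field.
have -> : l = r%:Z + z * (80 * k)%N%:Z by rewrite -lE subrK.
by rewrite intrD intrM; ring.
Qed.

Lemma guards_card_ge {R : realType} (k : nat) : (0 < k)%N ->
  `I_k #<= (guards k : set (R * R)).
Proof.
move=> k0; have w0 := pitch_gt0 (R := R) k0.
pose f (m : nat) : R * R := (5 * pitch k * m%:R, 1).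
apply: (@card_le_trans _ _ _ (f @` `I_k)).
  suff : f @` `I_k #= `I_k by rewrite card_eq_le => /andP[].
  apply: inj_card_eq => m n _ _ [] /mulfI.
  by move=> /(_ ltac:(by rewrite gt_eqF// mulr_gt0)) /eqP; rewrite eqr_nat => /eqP.
by apply: subset_card_le => _ [m mk <-]; left; left; exists m.
Qed.

Theorem theorem4 (R : realType) :
  exists (Theta : nat -> R) (n : nat -> nat) (G : nat -> set (R * R)),
    [/\ forall i, G i #= `I_(n i),
        forall i, 0 < Theta i,
        Theta @ \oo --> (0 : R),
        n @ \oo --> \oo &
        exists2 c : R, 0 < c &
          \forall i \near \oo,
            ((c * (n i)%:R ^+ 2)%:E <= complexity (region (Theta i) (G i)))%E].
Proof.
have /choice[n nE] : forall i : nat, exists n, (guards i.+1 : set (R * R)) #= `I_n.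
  move=> i; apply/finite_setP/finite_set_leP.
  by exists (82 * i.+1)%N; exact: guards_card_le.
have n_le i : (n i <= 82 * i.+1)%N.
  by rewrite -card_le_II -(card_le_eql (nE i)) guards_card_le.
have n_ge i : (i.+1 <= n i)%N.
  by rewrite -card_le_II -(card_le_eqr (nE i)) guards_card_ge.
exists (fun i => aperture i.+1), n, (fun i => guards i.+1); split=> //.
- by move=> i; have [] := andP (@aperture_bounds R i.+1 isT).
- have -> : (fun i => aperture i.+1) = (fun i => (pi / 40 * (33 / 32)) * harmonic i) :> (nat -> R).
    apply/funext => i; rewrite /aperture /slack /pitch /harmonic /=.
    have : i.+1%:R != 0 :> R by rewrite pnatr_eq0.
    by move: i.+1%:R => x x0; field.
  rewrite -[0](mulr0 (pi / 40 * (33 / 32))).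
  by apply: cvgM; [exact: cvg_cst|exact: cvg_harmonic].
- move=> A [N _ NA]; exists N => // i /= Ni; apply: NA => /=.
  by apply: leq_trans (n_ge i); exact: leqW.
(* With [k = i.+1], the bound [n i <= 82 * k] turns the complexity bound [k * k] into one in
   [n i]. *)
exists (1 / 82 ^+ 2); first by rewrite divr_gt0// exprn_gt0.
apply: nearW => i; apply: le_trans (@complexity_guards R i.+1 isT).
rewrite lee_fin natrM -expr2 mulrAC mul1r ler_pdivrMr ?exprn_gt0// -exprMn.
by rewrite ler_pXn2r ?nnegrE ?mulr_ge0// -natrM ler_nat mulnC.
Qed.
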